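(* Let $n,m\in\mathbb{N}$, let $A\in\{0,1\}^{n\times m}$ have no zero column, let $\{\mathbf{0}_m,\mathbf{e}_1,\dots,\mathbf{e}_m\}\subseteq X\subseteq\mathbb{R}^m_+$, and let $f:X\to\mathbb{R}$ satisfy $f(\mathbf{0}_m)=0$ and be individually subadditive, i.e. $f(x)\le\sum_{j=1}^m f(\mathbf{e}_j)x_j$ for all $x\in X$. For $w\in\{0,1\}^n$ define the partition game and its relaxation $$\nu^{\mathrm{ptn}}_{X,f}(w)=\max_{x\in X}[f(x):Ax=w]\in\mathbb{R},\qquad \nu^{\mathrm{ptn}}_{\mathbb{R}^m_+,F}(w)=\max_{x\in\mathbb{R}^m_+}\left[(f(\mathbf{e}_1),\dots,f(\mathbf{e}_m))x:Ax=w\right].$$ Then $$\mathrm{core}(\nu^{\mathrm{ptn}}_{X,f})\ne\emptyset\iff \nu^{\mathrm{ptn}}_{X,f}(\mathbf{1}_n)=\nu^{\mathrm{ptn}}_{\mathbb{R}^m_+,F}(\mathbf{1}_n).$$ Moreover, whenever the core is non-empty, $$\mathrm{core}(\nu^{\mathrm{ptn}}_{X,f})=\operatorname*{arg\,min}_{y\in\mathbb{R}^n}\left[\mathbf{1}_n^Ty:\ y^TA\ge(f(\mathbf{e}_1),\dots,f(\mathbf{e}_m))\right].$$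
   Context: Notation: $\mathbf{0}_n,\mathbf{1}_n$ are the all-zero and all-one vectors in $\mathbb{R}^n$; $\mathbf{e}_j$ is the $j$-th unit vector; $\mathbb{R}^m_+$ is the set of componentwise non-negative vectors; vector inequalities are componentwise. Standing convention: for every $w\in\{0,1\}^n$ the program defining $\nu^{\mathrm{ptn}}_{X,f}(w)$ is feasible and its maximum is attained, so $\nu^{\mathrm{ptn}}_{X,f}$ is real-valued. The core of a (revenue) game $\nu:\{0,1\}^n\to\mathbb{R}$ is $\mathrm{core}(\nu)=\{y\in\mathbb{R}^n:\mathbf{1}_n^Ty=\nu(\mathbf{1}_n),\ a^Ty\ge\nu(a)\ \forall a\in\{0,1\}^n\}$. *)

(* Defs.v *)
From HB Require Import structures.
From mathcomp Require Import all_boot all_order all_algebra.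
From mathcomp Require Import all_classical all_reals all_analysis.

Set Implicit Arguments.
Unset Strict Implicit.
Unset Printing Implicit Defensive.

Import Order.TTheory GRing.Theory Num.Theory.
Import numFieldNormedType.Exports.
Local Open Scope classical_set_scope.
Local Open Scope ring_scope.

Definition mx01 (R : realType) (p q : nat) (B : 'M[bool]_(p, q)) : 'M[R]_(p, q) :=
  map_mx (fun b : bool => b%:R) B.

Definition dot (R : realType) (p : nat) (u v : 'cV[R]_p) : R :=
  (u^T *m v) 0 0.

Definition unitv (R : realType) (m : nat) (j : 'I_m) : 'cV[R]_m := delta_mx j 0.

Definition nonneg_orthant (R : realType) (m : nat) : set 'cV[R]_m :=
  [set x | forall j, 0 <= x j 0].

Definition is_max (R : realType) (S : set R) (v : R) : Prop := S v /\ ubound S v.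

(* The greatest element of S; the value 0 is a dummy used only when S has no
   greatest element. *)
Definition max_of (R : realType) (S : set R) : R := xget 0 [set v | is_max S v].

Definition argmin (R : realType) (T : Type) (D : set T) (g : T -> R) : set T :=
  [set y | D y /\ forall z, D z -> g y <= g z].

(* An element w of {0,1}^n is a boolean column vector, so a game is a function
   'cV[bool]_n -> R and the grand coalition 1_n is const_mx true. *)
Definition core (R : realType) (n : nat) (nu : 'cV[bool]_n -> R) : set 'cV[R]_n :=
  [set y | dot (const_mx 1) y = nu (const_mx true) /\
           forall a : 'cV[bool]_n, nu a <= dot (mx01 R a) y].

Section PartitionGame.
Variables (R : realType) (n m : nat) (A : 'M[bool]_(n, m)).

(* f is a total function, but only its values on X are ever used. *)
Definition ptn_values (X : set 'cV[R]_m) (f : 'cV[R]_m -> R) (w : 'cV[bool]_n) :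
    set R :=
  [set f x | x in [set x | X x /\ mx01 R A *m x = mx01 R w]].

Definition ptn_well_posed (X : set 'cV[R]_m) (f : 'cV[R]_m -> R) : Prop :=
  forall w, exists v, is_max (ptn_values X f w) v.

Definition ptn_game (X : set 'cV[R]_m) (f : 'cV[R]_m -> R) (w : 'cV[bool]_n) : R :=
  max_of (ptn_values X f w).

End PartitionGame.

Definition unit_values (R : realType) (m : nat) (f : 'cV[R]_m -> R) : 'rV[R]_m :=
  \row_j f (unitv R j).

Definition relaxed_ptn_game (R : realType) (n m : nat) (A : 'M[bool]_(n, m))
    (f : 'cV[R]_m -> R) : 'cV[bool]_n -> R :=
  ptn_game A (@nonneg_orthant R m) (fun x => (unit_values f *m x) 0 0).

Definition individually_subadditive (R : realType) (m : nat)
    (X : set 'cV[R]_m) (f : 'cV[R]_m -> R) : Prop :=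
  forall x, X x -> f x <= \sum_(j < m) f (unitv R j) * x j 0.

Definition dual_feasible (R : realType) (n m : nat) (A : 'M[bool]_(n, m))
    (f : 'cV[R]_m -> R) : set 'cV[R]_n :=
  [set y | forall j, unit_values f 0 j <= (y^T *m mx01 R A) 0 j].

Lemma max_ofP (R : realType) (S : set R) :
  (exists v, is_max S v) -> is_max S (max_of S).
Proof. by move=> [v Sv]; exact: (@xgetPex _ 0 [set v | is_max S v] (ex_intro _ v Sv)). Qed.

(* The maximum defining the relaxed game is attained, so its value is never the
   dummy of max_of. *)
Lemma relaxed_well_posed (R : realType) (n m : nat) (A : 'M[bool]_(n, m))
    (X : set 'cV[R]_m) (f : 'cV[R]_m -> R)
    (A_col : forall j, exists i, A i j = true)
    (X_nonneg : X `<=` @nonneg_orthant R m)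
    (wp : ptn_well_posed A X f) :
  ptn_well_posed A (@nonneg_orthant R m) (fun x => (unit_values f *m x) 0 0).
Proof.
move=> w.
pose P : set 'rV[R]_m := [set x : 'rV[R]_m | (forall j, 0 <= x 0 j) /\
  forall i, \sum_j mx01 R A i j * x 0 j = mx01 R w i 0].
have PE (x : 'rV[R]_m) :
    P x <-> nonneg_orthant x^T /\ mx01 R A *m x^T = mx01 R w.
  split=> [[x0 xw]|[x0 xw]]; split.
  - by move=> j; rewrite mxE.
  - apply/matrixP => i j; rewrite ord1 -xw mxE.
    by apply: eq_bigr => k _; rewrite [in x^T _ _]mxE.
  - by move=> j; have := x0 j; rewrite mxE.
  - move=> i; rewrite -xw mxE.
    by apply: eq_bigr => k _; rewrite [in x^T _ _]mxE.
have P0 : P !=set0.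
  have [v [[x [Xx Ax] _] _]] := wp w.
  by exists x^T; apply/PE; rewrite trmxK; split=> //; exact: X_nonneg.
have cont (k : 'I_m -> R) : continuous (fun x : 'rV[R]_m => \sum_j k j * x 0 j).
  apply: continuous_big => [|j _ x]; first exact: add_continuous.
  by apply: continuousM; [exact: cst_continuous|exact: coord_continuous].
have Pcl : closed P.
  have -> : P = (\bigcap_j ((fun x : 'rV[R]_m => x 0 j) @^-1` [set y | 0 <= y]))
      `&` (\bigcap_i ((fun x : 'rV[R]_m => \sum_j mx01 R A i j * x 0 j) @^-1`
            [set y | y = mx01 R w i 0])).
    apply/seteqP; split=> x [p q]; split=> /= k; try move=> _.
    - exact: p.
    - exact: q.
    - exact: p.
    - exact: q.
  apply: closedI; apply: closed_bigI => k _; apply: preimage_closed.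
  - by move=> x _; exact: coord_continuous.
  - exact: closed_ge.
  - by move=> x _; exact: cont.
  - exact: closed_eq.
have Pco : compact P.
  apply: (subclosed_compact Pcl
    (@rV_compact R m (fun=> `[0, 1]%classic) (fun=> @segment_compact R 0 1))).
  move=> x [x0 xw] j /=; rewrite in_itv /= x0 /=.
  have [i Aij] := A_col j.
  have : mx01 R w i 0 <= 1 by rewrite mxE; case: (w i 0).
  apply: le_trans; rewrite -xw (bigD1 j) //= mxE Aij mul1r lerDl.
  by apply: sumr_ge0 => k _; rewrite mulr_ge0 // mxE.
have [c cP cmax] := EVT_max_rV P0 Pco
  (continuous_subspaceT (cont (fun j => unit_values f 0 j))).
have E (x : 'cV[R]_m) :
    \sum_j unit_values f 0 j * x^T 0 j = (unit_values f *m x) 0 0.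
  by rewrite [RHS]mxE; apply: eq_bigr => j _; rewrite [in x^T _ _]mxE.
rewrite inE in cP.
exists ((unit_values f *m c^T) 0 0); split; first by exists c^T => //; exact/PE.
move=> _ [x /= xP <-]; rewrite -!E trmxK.
by apply: cmax; rewrite inE; apply/PE; rewrite trmxK.
Qed.

(* Main.v *)
Require Import Defs.
From HB Require Import structures.
From mathcomp Require Import all_boot all_order all_algebra.
From mathcomp Require Import all_classical all_reals all_analysis.
From mathcomp Require Import ring lra.
Import Order.TTheory GRing.Theory Num.Theory.
Import numFieldNormedType.Exports.
Local Open Scope classical_set_scope.
Local Open Scope ring_scope.

(** Write [c] for the row of unit values [f (unitv R j)]. The argument rests on
    linear programming duality for the relaxed game.

    A core allocation [y] pays the coalition formed by column [j] of [A] at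
    least [c 0 j], so it satisfies [y^T A >= c] ([core_dual_feasible]).
    Conversely, individual subadditivity and weak duality show that every [y]
    with [y^T A >= c] pays each coalition at least its worth
    ([dual_feasible_ge]). Hence the core consists of the dual solutions whose
    total is exactly the worth of the grand coalition. As no dual solution has
    a smaller total, a non-empty core is the set of dual minimizers.

    For the grand coalition the worth is at most the relaxed value, which by
    weak duality is at most the total of any dual solution; a core allocation
    makes these bounds equalities. When the worth equals the relaxed value,
    strong duality ([lp_strong_duality]) gives a dual solution whose total is at
    most that value, and this solution lies in the core. Strong duality follows
    from Farkas' lemma ([farkas]), obtained by Fourier-Motzkin elimination. *)

(** * Linear programming duality *)

(** An inequality [d i <= p i * t] is a lower bound [d i / p i] on the unknown
    [t] when [p i] is positive and an upper bound when it is negative. *)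
Lemma interval_system_solvable (R : realFieldType) (I : finType) (p d : I -> R)
    (d_zero : forall i, p i = 0 -> d i <= 0)
    (d_pair : forall i k, 0 < p i -> p k < 0 -> d i / p i <= d k / p k) :
  exists t, forall i, d i <= p i * t.
Proof.
suff [t [lo up]] : exists t, (forall i, 0 < p i -> d i / p i <= t) /\
    (forall k, p k < 0 -> t <= d k / p k).
  exists t => i; case: (ltgtP (p i) 0) => pi.
  - by rewrite mulrC -ler_ndivlMr // up.
  - by rewrite mulrC -ler_pdivrMr // lo.
  - by rewrite pi mul0r d_zero.
have [i0 pi0|no_pos] := pickP (fun i => 0 < p i).
  case: (@arg_maxP _ _ I i0 (fun i => 0 < p i) (fun i => d i / p i) pi0).
  move=> i pi imax.
  by exists (d i / p i); split=> [k /imax|k pk] //; exact: d_pair.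
have [k0 pk0|no_neg] := pickP (fun k => p k < 0).
  case: (@arg_minP _ _ I k0 (fun k => p k < 0) (fun k => d k / p k) pk0).
  move=> k pk kmin.
  exists (d k / p k); split=> [i|i /kmin //].
  by rewrite no_pos.
by exists 0; split=> i; rewrite ?no_pos ?no_neg.
Qed.

(** Farkas' lemma for finitely many affine inequalities over an ordered
    field: if they have no common solution, some nonnegative combination of
    them reads [0 >= e] with [e] positive. *)
Lemma farkas (R : realFieldType) (n : nat) (I : finType)
    (a : I -> 'I_n -> R) (b : I -> R) :
  (exists y : 'I_n -> R, forall i, b i <= \sum_j a i j * y j) \/
  (exists l : I -> R, [/\ forall i, 0 <= l i,
     forall j, \sum_i l i * a i j = 0 & 0 < \sum_i l i * b i]).
Proof.
elim: n I a b => [|n IHn] I a b.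
  have [i bi|b_le0] := pickP (fun i => 0 < b i).
    right; exists (fun k => (k == i)%:R); split=> [k||]; rewrite ?ler0n //.
      by case.
    rewrite (bigD1 i) //= eqxx mul1r big1 ?addr0 // => k /negPf ->.
    by rewrite mul0r.
  by left; exists (fun=> 0) => i; rewrite big_ord0 leNgt b_le0.
pose p i := a i ord0.
(* Nonnegative combinations of the inequalities in which the first unknown
   cancels: [inl (i, k)] pairs a lower bound with an upper bound, and [inr i]
   keeps an inequality that is free of the first unknown. *)
pose w (J : I * I + I) (h : I) : R := match J with
  | inl (i, k) => if (0 < p i) && (p k < 0)
      then (h == i)%:R * - p k + (h == k)%:R * p i else 0
  | inr i => if p i == 0 then (h == i)%:R else 0
  end.
have sum_delta i (g : I -> R) : \sum_h (h == i)%:R * g h = g i.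
  rewrite (bigD1 i) //= eqxx mul1r big1 ?addr0 // => k /negPf ->.
  by rewrite mul0r.
have sum_pair i k (g : I -> R) : 0 < p i -> p k < 0 ->
    \sum_h w (inl (i, k)) h * g h = - p k * g i + p i * g k.
  move=> pi pk; rewrite /w pi pk /=.
  rewrite -(sum_delta i (fun h => - p k * g h)).
  rewrite -(sum_delta k (fun h => p i * g h)) -big_split /=.
  by apply: eq_bigr => h _; ring.
have sum_free i (g : I -> R) : p i = 0 -> \sum_h w (inr i) h * g h = g i.
  by move=> pi; rewrite /w pi eqxx sum_delta.
have w_ge0 J h : 0 <= w J h.
  case: J => [[i k]|i]; rewrite /w; case: ifP => //.
  by case/andP=> pi pk; rewrite addr_ge0 // mulr_ge0 ?ler0n ?oppr_ge0 ?ltW.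
have w_cancel J : \sum_h w J h * p h = 0.
  case: J => [[i k]|i]; last first.
    have [pi|pi] := eqVneq (p i) 0; first by rewrite sum_free.
    by apply: big1 => h _; rewrite /w (negPf pi) mul0r.
  have [/andP[pi pk]|nik] := boolP ((0 < p i) && (p k < 0)).
    by rewrite sum_pair //; ring.
  by apply: big1 => h _; rewrite /w (negPf nik) mul0r.
have [[y y_sol]|[l [l_ge0 l_a l_b]]] := IHn (I * I + I)%type
    (fun J j => \sum_h w J h * a h (lift ord0 j)) (fun J => \sum_h w J h * b h).
  left.
  pose s i := \sum_j a i (lift ord0 j) * y j.
  have comb J : \sum_h w J h * (b h - s h) <= 0.
    have -> : \sum_h w J h * (b h - s h) = \sum_h w J h * b h -
        \sum_j (\sum_h w J h * a h (lift ord0 j)) * y j.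
      under [X in _ - X]eq_bigr do rewrite big_distrl.
      rewrite exchange_big -sumrB; apply: eq_bigr => h _.
      rewrite mulrBr /s big_distrr; congr (_ - _).
      by apply: eq_bigr => j _ /=; rewrite mulrA.
    by rewrite subr_le0.
  have [] := @interval_system_solvable R I p (fun i => b i - s i).
  - by move=> i pi; rewrite -(sum_free i (fun h => b h - s h)).
  - move=> i k pi pk; have := comb (inl (i, k)).
    rewrite (sum_pair i k (fun h => b h - s h)) // => ik.
    rewrite ler_pdivrMr // mulrAC ler_ndivlMr //; lra.
  - move=> t t_sol; exists (fun j => oapp y t (unlift ord0 j)) => i.
    rewrite big_ord_recl unlift_none /=.
    under eq_bigr do rewrite liftK /=.
    by rewrite -lerBlDr t_sol.
(* A certificate for the reduced system, pulled back along the weights [w]. *)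
right; exists (fun h => \sum_J l J * w J h).
have swap (g : I -> R) : \sum_h (\sum_J l J * w J h) * g h =
    \sum_J l J * \sum_h w J h * g h.
  under eq_bigr do rewrite big_distrl.
  rewrite exchange_big; apply: eq_bigr => J _; rewrite big_distrr.
  by apply: eq_bigr => h _ /=; rewrite mulrA.
split=> [h|j|]; rewrite ?swap //.
  by apply: sumr_ge0 => J _; rewrite mulr_ge0.
have [j'|] := unliftP ord0 j => ->; first exact: l_a.
by apply: big1 => J _; rewrite w_cancel mulr0.
Qed.

(** Strong duality of linear programming: an upper bound [v] of a feasible
    maximization problem in standard form is certified by a dual solution. *)
Lemma lp_strong_duality (R : realFieldType) (n m : nat) (A : 'M[R]_(n, m))
    (b : 'cV[R]_n) (c : 'rV[R]_m) (v : R)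
    (feasible : exists x : 'cV[R]_m, (forall j, 0 <= x j 0) /\ A *m x = b)
    (bounded : forall x : 'cV[R]_m, (forall j, 0 <= x j 0) -> A *m x = b ->
       (c *m x) 0 0 <= v) :
  exists y : 'cV[R]_n,
    (forall j, c 0 j <= (y^T *m A) 0 j) /\ (y^T *m b) 0 0 <= v.
Proof.
(* The system consists of the dual constraints and of [v >= y^T b]; a
   certificate of its infeasibility is a pair of a vector [x] and a scalar
   [t] with [A x = t b] and [c x > t v]. *)
have [[y y_sol]|[l [l_ge0 l_A l_c]]] := @farkas R n ('I_m + unit)%type
    (fun s i => match s with inl j => A i j | inr _ => - b i 0 end)
    (fun s => match s with inl j => c 0 j | inr _ => - v end).
  exists (\col_i y i); split=> [j|].
    apply: le_trans (y_sol (inl j)) _; rewrite mxE le_eqVlt; apply/orP; left.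
    by apply/eqP/eq_bigr => i _; rewrite !mxE mulrC.
  have := y_sol (inr tt); rewrite /= lerNl => /(le_trans _); apply.
  rewrite mxE -sumrN le_eqVlt; apply/orP; left; apply/eqP/eq_bigr => i _.
  by rewrite !mxE; ring.
exfalso.
pose x : 'cV[R]_m := \col_j l (inl j); pose t := l (inr tt).
have x_ge0 j : 0 <= x j 0 by rewrite mxE.
have t_ge0 : 0 <= t := l_ge0 (inr tt).
have sum_unit (g : unit -> R) : \sum_u g u = g tt.
  by rewrite (bigD1 tt) //= big1 ?addr0 // => -[].
have Ax : A *m x = t *: b.
  apply/matrixP => i k; rewrite ord1 !mxE {k}; apply/eqP.
  have := l_A i; rewrite big_sumType sum_unit /= mulrN => /subr0_eq <-.
  by apply/eqP/eq_bigr => j _; rewrite mxE mulrC.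
have cx : t * v < (c *m x) 0 0.
  move: l_c; rewrite big_sumType sum_unit /= mulrN subr_gt0 mxE => /lt_le_trans.
  apply; rewrite le_eqVlt; apply/orP; left.
  by apply/eqP/eq_bigr => j _; rewrite mxE mulrC.
have [t0|t_neq0] := eqVneq t 0.
  (* [x] is a direction of recession along which the objective increases. *)
  rewrite t0 scale0r in Ax; rewrite t0 mul0r in cx.
  have [x0 [x0_ge0 Ax0]] := feasible.
  (* This step length brings the objective to [v] plus its value at [x]. *)
  pose s := (v - (c *m x0) 0 0) / (c *m x) 0 0 + 1.
  have s_ge0 : 0 <= s.
    by rewrite addr_ge0 // divr_ge0 ?(ltW cx) // subr_ge0 bounded.
  have := bounded (x0 + s *: x) _ _; rewrite leNgt => /(_ _ _)/negP; apply.
  - by move=> j; rewrite 2!mxE addr_ge0 // mulr_ge0.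
  - by rewrite mulmxDr -scalemxAr Ax scaler0 addr0.
  - have -> : (c *m (x0 + s *: x)) 0 0 = (c *m x0) 0 0 + s * (c *m x) 0 0.
      by rewrite mulmxDr -scalemxAr !mxE.
    by rewrite mulrDl mul1r divfK ?gt_eqF //; lra.
have t_gt0 : 0 < t by rewrite lt_def t_neq0.
have := bounded (t^-1 *: x) _ _; rewrite leNgt => /(_ _ _)/negP; apply.
- by move=> j; rewrite mxE mulr_ge0 ?invr_ge0.
- by rewrite -scalemxAr Ax scalerA mulVf // scale1r.
- by rewrite -scalemxAr mxE mulrC ltr_pdivlMr // mulrC.
Qed.

(** * Partition games and their cores *)

Lemma dotC (R : realType) (n : nat) (u v : 'cV[R]_n) : dot u v = dot v u.
Proof. by rewrite /dot !mxE; apply: eq_bigr => i _; rewrite !mxE mulrC. Qed.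

Lemma dot_mulmx (R : realType) (n m : nat) (B : 'M[R]_(n, m)) (x : 'cV[R]_m)
    (y : 'cV[R]_n) :
  dot (B *m x) y = \sum_j (y^T *m B) 0 j * x j 0.
Proof. by rewrite dotC /dot mulmxA mxE. Qed.

Lemma mx01_true (R : realType) (n : nat) :
  mx01 R (const_mx true : 'cV_n) = const_mx 1.
Proof. by apply/matrixP => i j; rewrite !mxE. Qed.

(** Weak duality, with an arbitrary coalition [w] as right-hand side. *)
Lemma weak_duality (R : realType) (n m : nat) (A : 'M[bool]_(n, m))
    (f : 'cV[R]_m -> R) (w : 'cV[bool]_n) (x : 'cV[R]_m) (y : 'cV[R]_n)
    (y_feas : dual_feasible A f y) (x_ge0 : nonneg_orthant x)
    (Ax : mx01 R A *m x = mx01 R w) :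
  \sum_j f (unitv R j) * x j 0 <= dot (mx01 R w) y.
Proof.
rewrite -Ax dot_mulmx; apply: ler_sum => j _.
by rewrite ler_wpM2r ?x_ge0 //; have := y_feas j; rewrite [unit_values _ _ _]mxE.
Qed.

Lemma ptn_game_max (R : realType) (n m : nat) (A : 'M[bool]_(n, m))
    (X : set 'cV[R]_m) (f : 'cV[R]_m -> R) (w : 'cV[bool]_n) :
  ptn_well_posed A X f -> is_max (ptn_values A X f w) (ptn_game A X f w).
Proof. by move=> f_wp; exact/max_ofP/f_wp. Qed.

(** The worth of the coalition given by column [j] of [A] is at least
    [f (unitv R j)]. *)
Lemma core_dual_feasible (R : realType) (n m : nat) (A : 'M[bool]_(n, m))
    (X : set 'cV[R]_m) (f : 'cV[R]_m -> R)
    (f_wp : ptn_well_posed A X f)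
    (X_unit : forall j, X (unitv R j)) :
  core (ptn_game A X f) `<=` dual_feasible A f.
Proof.
move=> y [_ y_ge] j; rewrite mxE.
have Aj : mx01 R A *m unitv R j = mx01 R (col j A).
  by rewrite /unitv -colE; apply/matrixP => i k; rewrite !mxE.
have -> : (y^T *m mx01 R A) 0 j = dot (mx01 R (col j A)) y.
  rewrite -Aj dot_mulmx (bigD1 j) //= big1 ?addr0.
    by rewrite [unitv _ _ _ _]mxE !eqxx mulr1.
  by move=> k /negPf kj; rewrite [unitv _ _ _ _]mxE kj mulr0.
apply: le_trans (y_ge _); have [_ ub] := ptn_game_max _ _ _ _ _ _ (col j A) f_wp.
by apply: ub; exists (unitv R j) => //; split=> //; exact: X_unit.
Qed.

(** By individual subadditivity and weak duality, a dual solution is an upper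
    bound on the worth of every coalition. *)
Lemma dual_feasible_ge (R : realType) (n m : nat) (A : 'M[bool]_(n, m))
    (X : set 'cV[R]_m) (f : 'cV[R]_m -> R)
    (f_wp : ptn_well_posed A X f)
    (X_nonneg : X `<=` @nonneg_orthant R m)
    (f_sub : individually_subadditive X f)
    (y : 'cV[R]_n) (w : 'cV[bool]_n) :
  dual_feasible A f y -> ptn_game A X f w <= dot (mx01 R w) y.
Proof.
move=> y_feas; have [[x [Xx Ax] <-] _] := ptn_game_max _ _ _ _ _ _ w f_wp.
apply: le_trans (f_sub x Xx) _.
by apply: weak_duality => //; exact: X_nonneg.
Qed.

Theorem theorem5 (R : realType) (n m : nat) (A : 'M[bool]_(n, m))
    (X : set 'cV[R]_m) (f : 'cV[R]_m -> R)
    (A_col : forall j, exists i, A i j = true)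
    (X_zero : X 0)
    (X_unit : forall j, X (unitv R j))
    (X_nonneg : X `<=` @nonneg_orthant R m)
    (f_zero : f 0 = 0)
    (f_sub : individually_subadditive X f)
    (f_wp : ptn_well_posed A X f) :
  (core (ptn_game A X f) !=set0 <->
     ptn_game A X f (const_mx true) = relaxed_ptn_game A f (const_mx true)) /\
  (core (ptn_game A X f) !=set0 ->
     core (ptn_game A X f) =
     argmin (dual_feasible A f) (dot (const_mx 1))).
Proof.
have core_feas := core_dual_feasible _ _ _ _ _ _ f_wp X_unit.
have feas_ge := dual_feasible_ge _ _ _ _ _ _ f_wp X_nonneg f_sub.
have unit_valuesE x : (unit_values f *m x) 0 0 = \sum_j f (unitv R j) * x j 0.
  by rewrite mxE; apply: eq_bigr => j _; rewrite mxE.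
have [[z [z_ge0 Az] zE] relax_ub] :
    is_max (ptn_values A (@nonneg_orthant R m)
              (fun x => (unit_values f *m x) 0 0) (const_mx true))
      (relaxed_ptn_game A f (const_mx true)).
  exact/ptn_game_max/(relaxed_well_posed A_col X_nonneg f_wp).
have [[x1 [Xx1 Ax1] x1E] _] :=
  ptn_game_max _ _ _ _ _ _ (const_mx true) f_wp.
split; last first.
  move=> [y0 y0_core]; have [y0_1 _] := y0_core; apply/seteqP; split=> y.
    move=> y_core; split; first exact: core_feas.
    move=> z' z'_feas; case: (y_core) => -> _.
    by rewrite -[X in dot X]mx01_true feas_ge.
  move=> [y_feas y_min]; split; last by move=> a; exact: feas_ge.
  apply/eqP; rewrite eq_le -{1}y0_1 y_min //=; last exact: core_feas.
  by rewrite -[X in dot X]mx01_true feas_ge.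
split=> [[y y_core]|game_eq].
  apply/eqP; rewrite eq_le; apply/andP; split.
    rewrite -x1E; apply: le_trans (f_sub _ Xx1) _.
    rewrite -unit_valuesE; apply: relax_ub.
    by exists x1 => //; split=> //; exact: X_nonneg.
  have [<- _] := y_core; rewrite -zE unit_valuesE -mx01_true.
  exact: (weak_duality _ _ _ _ _ _ _ _ (core_feas _ y_core) z_ge0 Az).
have [||y [y_feas y_le]] := @lp_strong_duality R n m (mx01 R A) (const_mx 1)
    (unit_values f) (relaxed_ptn_game A f (const_mx true)).
- by exists z; split=> //; rewrite Az mx01_true.
- move=> x x_ge0 Ax; apply: relax_ub; exists x => //; split=> //.
  by rewrite mx01_true.
exists y; split; last by move=> a; exact: feas_ge.
apply/eqP; rewrite eq_le -{2}mx01_true feas_ge // andbT game_eq.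
by rewrite dotC.
Qed.
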